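(* Let $H$ be a self-adjoint complex Hadamard matrix of order $9$ all of whose diagonal entries equal $1$. Then there is a complex number $a$ with $|a|=1$ such that $H$ is equivalent to the matrix \[H_9^{(1)}(a)=\left[ \begin{array}{ccc|ccc|ccc} 1 & 1 & 1 & 1 & 1 & 1 & 1 & 1 & 1 \\ 1 & 1 & 1 & \omega & \omega & \omega & \omega^2 & \omega^2 & \omega^2 \\ 1 & 1 & 1 & \omega^2 & \omega^2 & \omega^2 & \omega & \omega & \omega \\ \hline 1 & \omega^2 & \omega & 1 & \omega^2 & \omega & a & a \omega^2 & a \omega \\ 1 & \omega^2 & \omega & \omega & 1 & \omega^2 & a \omega^2 & a \omega & a \\ 1 & \omega^2 & \omega & \omega^2 & \omega & 1 & a \omega & a & a \omega^2 \\ \hline 1 & \omega & \omega^2 & \overline{a} & \overline{a}\omega & \overline{a}\omega^2 & 1 & \omega & \omega^2 \\ 1 & \omega & \omega^2 & \overline{a}\omega & \overline{a}\omega^2 & \overline{a} & \omega^2 & 1 & \omega \\ 1 & \omega & \omega^2 & \overline{a}\omega^2 & \overline{a} & \overline{a}\omega & \omega & \omega^2 & 1 \end{array} \right],\] where $\omega=-\frac12+\mathbf{i}\frac{\sqrt3}{2}$.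
   Context: A complex Hadamard matrix of order $n$ is an $n\times n$ complex matrix $H$ all of whose entries have modulus $1$ and which satisfies $HH^\ast=nI_n$. Two self-adjoint matrices $A,B$ of the same order are called equivalent if $B=PDAD^\ast P^T$ for some permutation matrix $P$ and some unitary diagonal matrix $D$. *)

(* Defs.v *)
From HB Require Import structures.
From mathcomp Require Import all_boot all_order all_fingroup all_algebra.
From mathcomp Require Import sesquilinear spectral.
From mathcomp Require Import reals.
From mathcomp Require Import complex.

Set Implicit Arguments.
Unset Strict Implicit.
Unset Printing Implicit Defensive.

Import Order.TTheory GRing.Theory Num.Theory.

Local Open Scope ring_scope.
Local Open Scope complex_scope.
Local Open Scope sesquilinear_scope.

Definition complex_hadamard (C : numClosedFieldType) (n : nat) (H : 'M[C]_n)
    : Prop :=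
  (forall i j, `|H i j| = 1) /\ H *m H ^t* = n%:R%:M.

(* Only meant for self-adjoint matrices, a class preserved by the operation. *)
Definition hermitian_equiv (C : numClosedFieldType) (n : nat) (A B : 'M[C]_n)
    : Prop :=
  exists P D : 'M[C]_n,
    [/\ is_perm_mx P, is_diag_mx D, D \is unitarymx
      & B = P *m D *m A *m D ^t* *m P^T].

Definition omega (R : realType) : R[i] :=
  (- (1 / 2)) +i* (Num.sqrt 3 / 2).

Definition H9_rows (R : realType) (a : R[i]) : seq (seq R[i]) :=
  let w := omega R in
  let w2 := w ^+ 2 in
  let b := a^* in
  [:: [:: 1; 1 ; 1 ; 1     ; 1     ; 1     ; 1     ; 1     ; 1     ];
      [:: 1; 1 ; 1 ; w     ; w     ; w     ; w2    ; w2    ; w2    ];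
      [:: 1; 1 ; 1 ; w2    ; w2    ; w2    ; w     ; w     ; w     ];

      [:: 1; w2; w ; 1     ; w2    ; w     ; a     ; a * w2; a * w ];
      [:: 1; w2; w ; w     ; 1     ; w2    ; a * w2; a * w ; a     ];
      [:: 1; w2; w ; w2    ; w     ; 1     ; a * w ; a     ; a * w2];

      [:: 1; w ; w2; b     ; b * w ; b * w2; 1     ; w     ; w2    ];
      [:: 1; w ; w2; b * w ; b * w2; b     ; w2    ; 1     ; w     ];
      [:: 1; w ; w2; b * w2; b     ; b * w ; w     ; w2    ; 1     ]].

Definition H9 (R : realType) (a : R[i]) : 'M[R[i]]_9 :=
  \matrix_(i < 9, j < 9) (nth [::] (H9_rows a) i)`_j.

(* Main.v *)
(** The matrix [G = 3 - H] satisfies [G^2 = 6 G] and has trace 18: up to scaling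
it is the Gram matrix of nine equiangular lines in dimension 3, which form a
projective 2-design.  The design property says that the entrywise square of [H]
is again a Hadamard matrix.  Iterating, for [i != j] the nine unimodular numbers
[z_k = H i j * H j k * H k i] have vanishing power sums of exponents 1, 2 and 4,
so [\prod_k (X - z_k)] is a polynomial in [X^3]; as [z_i = z_j = 1], it equals
[(X^3 - 1)^2 (X^3 - c^3)] and the multiset of the [z_k] is known up to [c].  A
counting argument on the cubes [z_k^3] then yields distinct [i], [j], [k] with
[H i j * H j k * H k i = 1].  After normalization this gives the first three rows
of the target, and orthogonality of the rows determines the other six. *)

Require Import Defs.
From mathcomp Require Import all_boot all_order all_fingroup all_algebra.
From mathcomp Require Import sesquilinear spectral.
From mathcomp Require Import reals.
From mathcomp Require Import complex.
From mathcomp Require Import ring zify.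

Set Implicit Arguments.
Unset Strict Implicit.
Unset Printing Implicit Defensive.

Import Order.TTheory GRing.Theory Num.Theory.

Local Open Scope ring_scope.

(** * Newton's identities and reciprocal polynomials *)

Section PowerSums.
Variable F : numFieldType.
Implicit Types (s : seq F) (z : F).

Let psum s m := \sum_(z <- s) z ^+ m.

(** Up to the sign [(-1)^j], the coefficient of ['X^j] is the [j]-th elementary symmetric function,
    so these are Newton's identities. In degree 4 the third power sum occurs only multiplied by the
    first, which is why exponents 1, 2 and 4 suffice below. *)
Lemma coef_prod_1subX s (P := \prod_(z <- s) (1 - z *: 'X)) :
  [/\ P`_0 = 1, P`_1 = - psum s 1, P`_2 = (psum s 1 ^+ 2 - psum s 2) / 2,
      P`_3 = (- psum s 1 ^+ 3 + 3 * psum s 1 * psum s 2 - 2 * psum s 3) / 6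
    & P`_4 = (psum s 1 ^+ 4 - 6 * psum s 1 ^+ 2 * psum s 2 + 3 * psum s 2 ^+ 2
              + 8 * psum s 1 * psum s 3 - 6 * psum s 4) / 24].
Proof.
rewrite {}/P /psum; elim: s => [|z s]; first by rewrite !big_nil !coefC /=; split; field.
set P := \prod_(_ <- s) _; rewrite !big_cons -/P => -[IH0 IH1 IH2 IH3 IH4].
by split; rewrite mulrBl mul1r -scalerAl !coefE /= ?IH0 ?IH1 ?IH2 ?IH3 ?IH4; field.
Qed.

Lemma coef_prod_XsubC_rev s i j : (i + j = size s)%N ->
  (\prod_(z <- s) ('X - z%:P))`_i = (\prod_(z <- s) (1 - z *: 'X))`_j.
Proof.
elim: s i j => [|z s IH] i j /= ij.
  by case: i j ij => [|i] [|j] //; rewrite !big_nil.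
(* The two coefficients beyond the degree settle the end cases [j = 0] and [i = 0]. *)
have P0 : (\prod_(z <- s) ('X - z%:P))`_(size s).+1 = 0.
  by rewrite nth_default // size_prod_XsubC.
have Q0 : (\prod_(z <- s) (1 - z *: 'X))`_(size s).+1 = 0.
  rewrite nth_default //; elim: (s) => [|y t IHt]; first by rewrite big_nil size_poly1.
  rewrite big_cons (leq_trans (size_polyMleq _ _)) //=.
  have : (size (1 - y *: 'X : {poly F})%R <= 2)%N.
    rewrite (leq_trans (size_polyD _ _)) // size_poly1 geq_max /= size_polyN.
    by rewrite (leq_trans (size_scale_leq _ _)) // size_polyX.
  by move=> b; rewrite -subn1 leq_subLR; apply: leq_trans (leq_add b IHt) _.
rewrite !big_cons mulrBl mulrBl mul1r -scalerAl !coefE.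
case: i j ij => [|i] [|j] //= ij.
- have -> : j = size s by lia.
  by rewrite Q0 (IH 0 (size s)) //; ring.
- have -> : i = size s by lia.
  by rewrite P0 (IH (size s) 0) ?addn0 //; ring.
- by rewrite (IH i j.+1) 1?(IH i.+1 j) //; lia.
Qed.

End PowerSums.

(** * Nine unimodular numbers with vanishing power sums *)

Section UnimodularRoots.
Variable C : numClosedFieldType.
Implicit Types (s : seq C) (z w c : C).

Lemma conj_unimodular z : `|z| = 1 -> z^* = z^-1.
Proof. by move=> z1; rewrite invC_norm z1 expr1n invr1 mul1r. Qed.

Lemma unimodular_neq0 z : `|z| = 1 -> z != 0.
Proof. by move=> z1; rewrite -normr_eq0 z1 oner_eq0. Qed.

(** Newton's identities kill the coefficients of degree 8, 7 and 5. Conjugation inverts unimodular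
    numbers, so the inverses have vanishing power sums too, which kills degrees 1, 2 and 4. *)
Lemma prod_XsubC_lacunary s : size s = 9 -> {in s, forall z, `|z| = 1} ->
    (forall m, m \in [:: 1; 2; 4]%N -> \sum_(z <- s) z ^+ m = 0) ->
  exists a b d, \prod_(z <- s) ('X - z%:P) =
    'X^9 + a *: 'X^6 + b *: 'X^3 + d%:P.
Proof.
move=> s9 s1 s0; set P := \prod_(z <- s) _.
have [H0 H1 H2 H3 H4] := coef_prod_1subX s.
rewrite !(s0 1, s0 2, s0 4) // in H1 H2 H4.
pose t := [seq z^* | z <- s].
have t0 m : m \in [:: 1; 2; 4]%N -> \sum_(z <- t) z ^+ m = 0.
  move=> /s0 sm; rewrite /t big_map -[RHS](rmorph0 Num.conj) -[in RHS]sm rmorph_sum.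
  by apply: eq_bigr => z _; rewrite rmorphXn.
have [K0 K1 K2 K3 K4] := coef_prod_1subX t.
rewrite !(t0 1, t0 2, t0 4) // in K1 K2 K4.
(* For [|z| = 1], ['X - z] equals [- z (1 - z^* 'X)]. *)
have PE : P = (\prod_(z <- s) - z) *: \prod_(z <- t) (1 - z *: 'X).
  rewrite big_map /P -scaler_prod big_seq [RHS]big_seq; apply: eq_bigr => z zs.
  rewrite conj_unimodular ?s1 // scalerBr scalerA mulNr divff ?unimodular_neq0 ?s1 //.
  by rewrite scaleN1r opprK addrC -alg_polyC scaleNr.
have Plow i : P`_i = (\prod_(z <- s) - z) * (\prod_(z <- t) (1 - z *: 'X))`_i.
  by rewrite PE coefZ.
have Phigh i j : (i + j = 9)%N -> P`_i = (\prod_(z <- s) (1 - z *: 'X))`_j.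
  by move=> ij; apply: coef_prod_XsubC_rev; rewrite s9.
exists P`_6, P`_3, P`_0; apply/polyP => i.
do 10?[case: i => [|i]]; last by rewrite nth_default ?size_prod_XsubC ?s9 // !coefE /=; ring.
all: rewrite !coefE /=.
- by ring.
- by rewrite Plow K1; ring.
- by rewrite Plow K2; field.
- by ring.
- by rewrite Plow K4; field.
- by rewrite (Phigh 5 4) // H4; field.
- by ring.
- by rewrite (Phigh 7 2) // H2; field.
- by rewrite (Phigh 8 1) // H1; field.
- by rewrite (Phigh 9 0) // H0; field.
Qed.

Definition cube_roots (w c : C) := [seq x * y | x <- [:: 1; 1; c], y <- [:: 1; w; w ^+ 2]].

Lemma prod_cube_roots w c : w ^+ 2 + w + 1 = 0 ->
  \prod_(z <- cube_roots w c) ('X - z%:P) = ('X^3 - 1) ^+ 2 * ('X^3 - (c ^+ 3)%:P).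
Proof.
move=> w0; pose u := w%:P; have u0 : u ^+ 2 + u + 1 = 0.
  by rewrite /u -polyC_exp -polyC1 -!polyCD w0.
have XE x : \prod_(y <- [:: 1; w; w ^+ 2]) ('X - (x * y)%:P) = 'X^3 - (x ^+ 3)%:P.
  rewrite !big_cons big_nil !mulr1 (polyCM x w) (polyCM x (w ^+ 2)) !polyC_exp -/u.
  set v := x%:P.
  apply/eqP; rewrite -subr_eq0; apply/eqP.
  (* The difference is an explicit multiple of the relation [u0]. *)
  transitivity ((u ^+ 2 + u + 1) * (- v * 'X^2 + v ^+ 2 * u * 'X - v ^+ 3 * (u - 1))).
    by ring.
  by rewrite u0 mul0r.
rewrite /cube_roots /= !big_cons big_nil.
have := (XE 1, XE c); rewrite !big_cons !big_nil !mulr1 !mul1r expr1n polyC1 => -[E1 Ec].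
rewrite -Ec -E1; ring.
Qed.

(** As 1 is at least a double root, the polynomial and its derivative vanish at 1. These two linear
    equations leave only [a] free among the coefficients. *)
Lemma perm_cube_roots w s : w ^+ 2 + w + 1 = 0 ->
    size s = 9 -> {in s, forall z, `|z| = 1} -> (1 < count_mem 1%R s)%N ->
    (forall m, m \in [:: 1; 2; 4]%N -> \sum_(z <- s) z ^+ m = 0) ->
  exists c, perm_eq s (cube_roots w c).
Proof.
move=> w0 s9 s1 s11 s0; have [a [b [d PE]]] := prod_XsubC_lacunary s9 s1 s0.
have s1in : 1 \in s by rewrite -has_pred1 has_count (ltn_trans _ s11).
have e1 := perm_to_rem s1in.
have s2in : 1 \in rem 1 s.
  by rewrite -has_pred1 has_count; move: s11; rewrite (seq.permP e1) /= eqxx.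
have e2 := perm_to_rem s2in.
have e12 : perm_eq s [:: 1, 1 & rem 1 (rem 1 s)] by rewrite (permPl e1) perm_cons.
set R := \prod_(z <- rem 1 (rem 1 s)) ('X - z%:P).
have PR : ('X - 1%:P) * (('X - 1%:P) * R) = 'X^9 + a *: 'X^6 + b *: 'X^3 + d%:P.
  by rewrite -PE (perm_big _ e12) !big_cons.
have := congr1 (horner^~ 1) PR; have := congr1 (fun p => p^`().[1]) PR.
rewrite /= !derivE !hornerE /= => h1 h0.
have {}h1 : 9 + 6 * a + 3 * b = 0 by apply: etrans (etrans (esym h1) _); ring.
have {}h0 : 1 + a + b + d = 0 by apply: etrans (etrans (esym h0) _); ring.
have bE : b = - 3 - 2 * a.
  transitivity ((9 + 6 * a + 3 * b) / 3 - 3 - 2 * a); first by field.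
  by rewrite h1 mul0r add0r.
have dE : d = 2 + a.
  transitivity (1 + a + b + d - 1 - a - b); first by ring.
  by rewrite h0 bE; ring.
(* The double root 1 makes the product [(Y - 1)^2 (Y + 2 + a)] for [Y = X^3]. *)
exists (3.-root (- (2 + a))).
apply: prod_XsubC_eq; rewrite PE prod_cube_roots // rootCK // bE dE.
rewrite -!mul_polyC !(polyCN, polyCD, polyCM, polyC_natr).
by ring.
Qed.
End UnimodularRoots.

Section SumProd.
Variables (I : finType) (R : comNzRingType).
Implicit Types A B C D : I -> R.

Lemma sum_prod4 A B C D :
  \sum_(p : I * I * (I * I)) A p.1.1 * B p.1.2 * (C p.2.1 * D p.2.2) =
  (\sum_a A a) * (\sum_b B b) * ((\sum_c C c) * (\sum_d D d)).
Proof.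
transitivity (\sum_(p : I * I) \sum_(q : I * I) A p.1 * B p.2 * (C q.1 * D q.2)).
  by rewrite pair_bigA.
have pairs (E F : I -> R) : (\sum_a E a) * (\sum_b F b) = \sum_(q : I * I) E q.1 * F q.2.
  by rewrite big_distrlr pair_bigA.
by rewrite !pairs big_distrlr.
Qed.
End SumProd.

(** * The design property and the entrywise square *)

Section Hadamard9.
Variable C : numClosedFieldType.

(** Entries form a function rather than a matrix, so that the entrywise square and the normalized
    entries below are directly instances. *)
Definition sa_hadamard9 (h : 'I_9 -> 'I_9 -> C) : Prop :=
  [/\ forall i j, h j i = (h i j)^*, forall i j, `|h i j| = 1, forall i, h i i = 1
    & forall i j, \sum_k h i k * h k j = 9 * (i == j)%:R].

Section Design.
Variable g : 'I_9 -> 'I_9 -> C.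
Hypotheses (g_conj : forall i j, g j i = (g i j)^*) (g_diag : forall i, g i i = 2).
Hypothesis g_norm : forall i j, i != j -> g i j * g j i = 1.
Hypothesis g_sq : forall i j, \sum_k g i k * g k j = 6 * g i j.

Let I4 := ('I_9 * 'I_9 * ('I_9 * 'I_9))%type.
Let X (p : I4) := \sum_k g p.1.1 k * g p.1.2 k * (g k p.2.1 * g k p.2.2).
Let Y (p : I4) := g p.1.1 p.2.1 * g p.1.2 p.2.2.
Let Z (p : I4) := g p.1.1 p.2.2 * g p.1.2 p.2.1.
(* With [g m k = <v_m, v_k>], [X] is the matrix of the sum of the projectors on
   the [v_m (x) v_m], and [Y + Z] is twice the symmetrizer. *)
Let T p := X p - 3 * (Y p + Z p).
Let sw (p : I4) : I4 := (p.2, p.1).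

(** With pairs as row and column indices, [\sum_p F p * G (sw p)] is the trace of the product of [F]
    and [G]. Here [g_sq] reduces it to [6^4] times the sum of all [|g k l|^4], and each row
    contributes [16 + 8]. *)
Let XX : \sum_p X p * X (sw p) = 6 ^+ 7.
Proof.
transitivity (\sum_k \sum_l (6 * g k l) ^+ 2 * (6 * g l k) ^+ 2).
  transitivity (\sum_k \sum_l \sum_p
     (g l p.1.1 * g p.1.1 k) * (g l p.1.2 * g p.1.2 k) *
     ((g k p.2.1 * g p.2.1 l) * (g k p.2.2 * g p.2.2 l))).
    under [RHS]eq_bigr => k _ do rewrite exchange_big.
    rewrite [RHS]exchange_big; apply: eq_bigr => p _.
    rewrite big_distrlr; apply: eq_bigr => k _; apply: eq_bigr => l _ /=; ring.
  apply: eq_bigr => k _; apply: eq_bigr => l _.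
  rewrite (sum_prod4 (fun a => g l a * g a k) (fun a => g l a * g a k)
    (fun a => g k a * g a l) (fun a => g k a * g a l)).
  by rewrite !g_sq; ring.
transitivity (\sum_(k < 9) (4 * 6 ^+ 5 : C)); last by rewrite sumr_const card_ord; ring.
apply: eq_bigr => k _; rewrite (bigD1 k) //= g_diag.
transitivity ((6 * 2) ^+ 2 * (6 * 2) ^+ 2 + \sum_(l < 9 | l != k) (6 ^+ 4 : C)).
  congr (_ + _); apply: eq_bigr => l lk.
  by transitivity (6 ^+ 4 * (g k l * g l k) ^+ 2); [ring | rewrite g_norm 1?eq_sym //; ring].
by rewrite sumr_const cardC1 card_ord /=; ring.
Qed.

(** This trace is the square of [tr g^2 = 6 * 18]. *)
Let YY : \sum_p Y p * Y (sw p) = 9 * 6 ^+ 4.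
Proof.
transitivity (\sum_(p : I4) (g p.1.1 p.2.1 * g p.2.1 p.1.1) * (g p.1.2 p.2.2 * g p.2.2 p.1.2)).
  by apply: eq_bigr => p _; rewrite /Y /=; ring.
transitivity (\sum_(p : 'I_9 * 'I_9) \sum_(q : 'I_9 * 'I_9)
   (g p.1 q.1 * g q.1 p.1) * (g p.2 q.2 * g q.2 p.2)).
  by rewrite pair_bigA.
transitivity (\sum_(p : 'I_9 * 'I_9) (144 : C)); last first.
  by rewrite sumr_const card_prod card_ord; ring.
apply: eq_bigr => p _.
rewrite -(pair_bigA _ (fun q1 q2 => (g p.1 q1 * g q1 p.1) * (g p.2 q2 * g q2 p.2))) /=.
by rewrite -big_distrlr /= !g_sq !g_diag; ring.
Qed.

(** The crossed indices merge into one closed walk: the trace is [tr g^4 = 6^3 * 18]. *)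
Let YZ : \sum_p Y p * Z (sw p) = 3 * 6 ^+ 4.
Proof.
transitivity (\sum_(p : 'I_9 * 'I_9) \sum_(q : 'I_9 * 'I_9)
   (g p.2 q.2 * g q.2 p.1) * (g p.1 q.1 * g q.1 p.2)).
  rewrite pair_bigA; apply: eq_bigr => p _; rewrite /Y /Z /=; ring.
transitivity (\sum_(p : 'I_9 * 'I_9) 36 * (g p.1 p.2 * g p.2 p.1)).
  apply: eq_bigr => p _.
  rewrite -(pair_bigA _ (fun q1 q2 => (g p.2 q2 * g q2 p.1) * (g p.1 q1 * g q1 p.2))) /=.
  by rewrite exchange_big -big_distrlr /= !g_sq; ring.
rewrite -(pair_bigA _ (fun p1 p2 => 36 * (g p1 p2 * g p2 p1))) /=.
transitivity (\sum_(k < 9) (432 : C)); last by rewrite sumr_const card_ord; ring.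
by apply: eq_bigr => k _; rewrite -mulr_sumr g_sq g_diag; ring.
Qed.

(** For each [k] the inner sum is the square of the diagonal entry of [g^3] at [k], which is
    [36 * 2]. *)
Let XY : \sum_p X p * Y (sw p) = 6 ^+ 6.
Proof.
under eq_bigr => p _ do rewrite mulr_suml.
rewrite exchange_big /=.
transitivity (\sum_(k < 9) (4 * 6 ^+ 4 : C)); last by rewrite sumr_const card_ord; ring.
apply: eq_bigr => k _.
transitivity (\sum_(p : 'I_9 * 'I_9) \sum_(q : 'I_9 * 'I_9)
   g p.1 k * g p.2 k * ((g k q.1 * g q.1 p.1) * (g k q.2 * g q.2 p.2))).
  rewrite pair_bigA; apply: eq_bigr => p _; rewrite /Y /=; ring.
transitivity (\sum_(p : 'I_9 * 'I_9) 36 * ((g k p.1 * g p.1 k) * (g k p.2 * g p.2 k))).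
  apply: eq_bigr => p _; rewrite -mulr_sumr.
  rewrite -(pair_bigA _ (fun q1 q2 => (g k q1 * g q1 p.1) * (g k q2 * g q2 p.2))) /=.
  by rewrite -big_distrlr /= !g_sq; ring.
rewrite -mulr_sumr.
rewrite -(pair_bigA _ (fun p1 p2 => (g k p1 * g p1 k) * (g k p2 * g p2 k))) /=.
by rewrite -big_distrlr /= !g_sq g_diag; ring.
Qed.

(** This involution exchanges [Y] and [Z] and fixes [X], so the traces with [Z] follow from those
    with [Y]. *)
Let tw (p : I4) : I4 := (p.1, (p.2.2, p.2.1)).

Let sum_sw (f : I4 -> C) : \sum_p f p = \sum_p f (sw p).
Proof. by apply: reindex_inj => -[[? ?] [? ?]] [[? ?] [? ?]] [-> -> -> ->]. Qed.

Let sum_tw (f : I4 -> C) : \sum_p f p = \sum_p f (tw p).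
Proof. by apply: reindex_inj => -[[? ?] [? ?]] [[? ?] [? ?]] [-> -> -> ->]. Qed.

Let X_tw p : X (tw p) = X p.
Proof. by apply: eq_bigr => k _ /=; ring. Qed.

(* [T (sw p)] is the conjugate of [T p]: this is the squared Hilbert-Schmidt norm. *)
Lemma tensor_design_sum0 : \sum_p T p * T (sw p) = 0.
Proof.
have XZ : \sum_p X p * Z (sw p) = 6 ^+ 6.
  by rewrite sum_tw -XY; apply: eq_bigr => p _; rewrite X_tw /Y /Z /=; ring.
have YX : \sum_p Y p * X (sw p) = 6 ^+ 6.
  by rewrite sum_sw -XY; apply: eq_bigr => -[p q] _; rewrite mulrC.
have ZX : \sum_p Z p * X (sw p) = 6 ^+ 6.
  by rewrite sum_sw -XZ; apply: eq_bigr => -[p q] _; rewrite mulrC.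
have ZY : \sum_p Z p * Y (sw p) = 3 * 6 ^+ 4.
  by rewrite sum_sw -YZ; apply: eq_bigr => -[p q] _; rewrite mulrC.
have ZZ : \sum_p Z p * Z (sw p) = 9 * 6 ^+ 4.
  by rewrite sum_tw -YY; apply: eq_bigr => p _; rewrite /Y /Z /=; ring.
(* The total is [6^7 - 12 * 6^6 + 216 * 6^4 = 6^7 - 2 * 6^7 + 6^7]. Equal numerals are then replaced
   one occurrence at a time, each by a different trace. *)
transitivity (6 ^+ 7 - 3 * (6 ^+ 6) - 3 * (6 ^+ 6) - 3 * (6 ^+ 6) - 3 * (6 ^+ 6)
   + 9 * (9 * 6 ^+ 4) + 9 * (3 * 6 ^+ 4) + 9 * (3 * 6 ^+ 4) + 9 * (9 * 6 ^+ 4) : C); last by ring.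
rewrite -{1}XX -{1}XY -{1}XZ -{1}YX -{1}ZX -{1}YY -{1}YZ -{1}ZY -ZZ.
rewrite !mulr_sumr -!sumrB -!big_split /=.
by apply: eq_bigr => p _; rewrite /T; ring.
Qed.

(** [T] is self-adjoint, so [tensor_design_sum0] is a vanishing sum of squared moduli and every
    entry of [T] is zero. *)
Lemma tensor_design i j k l :
  \sum_m g i m * g j m * (g m k * g m l) = 3 * (g i k * g j l + g i l * g j k).
Proof.
have T_sw p : T (sw p) = (T p)^*.
  rewrite /T /X /Y /Z /sw rmorphB rmorph_sum /=.
  rewrite rmorphM rmorph_nat rmorphD !rmorphM /= -!g_conj.
  congr (_ - _); last by ring.
  by apply: eq_bigr => m _; rewrite !rmorphM /= -!g_conj; ring.
have /eqP := tensor_design_sum0.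
under eq_bigr => p _ do rewrite T_sw.
rewrite psumr_eq0 => [/allP /(_ ((i, j), (k, l)))|p _]; last by rewrite mul_conjC_ge0.
by rewrite mem_index_enum mul_conjC_eq0 subr_eq0 => /(_ isT) /eqP.
Qed.

End Design.

(** Taking equal indices in [tensor_design] shows that the entrywise square [K] of [g = 3 - h]
    satisfies [K^2 = 6 K]. The entrywise square of [h] is [K - 3], whose square is therefore 9. *)
Lemma sa_hadamard9_sq h : sa_hadamard9 h -> sa_hadamard9 (fun i j => h i j ^+ 2).
Proof.
move=> [hC h1 hd h9]; split.
- by move=> i j; rewrite hC rmorphXn.
- by move=> i j; rewrite normrX h1 expr1n.
- by move=> i; rewrite hd expr1n.
pose d (i j : 'I_9) : C := (i == j)%:R.
pose g i j := 3 * d i j - h i j.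
have dS (f : 'I_9 -> C) i : \sum_k d i k * f k = f i.
  rewrite (bigD1 i) //= /d eqxx mul1r big1 ?addr0 // => k ki.
  by rewrite eq_sym (negPf ki) mul0r.
have dC i j : d i j = d j i by rewrite /d eq_sym.
have gC i j : g j i = (g i j)^*.
  by rewrite /g rmorphB rmorphM !rmorph_nat /= -hC dC.
have gd i : g i i = 2 by rewrite /g /d eqxx hd /=; ring.
have gh i j : i != j -> g i j = - h i j.
  by rewrite /g /d => /negPf ->; rewrite mulr0 sub0r.
have gn i j : i != j -> g i j * g j i = 1.
  move=> ij; rewrite gh // gh 1?eq_sym // mulrNN (hC i j).
  by rewrite -normCK h1 expr1n.
have gs i j : \sum_k g i k * g k j = 6 * g i j.
  transitivity (9 * (\sum_k d i k * d j k) - 3 * (\sum_k d i k * h k j)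
    - 3 * (\sum_k d j k * h i k) + \sum_k h i k * h k j).
    rewrite !mulr_sumr -!sumrB -big_split; apply: eq_bigr => k _.
    by rewrite /= /g (dC k j); ring.
  by rewrite !dS h9 /g (dC j i) -/(d i j); ring.
have hg i j : h i j ^+ 2 = g i j ^+ 2 - 3 * d i j.
  rewrite /g /d; case: eqP => [->|_] /=; last by ring.
  by rewrite hd; ring.
move=> i j; rewrite -/(d i j).
transitivity (\sum_m g i m * g i m * (g m j * g m j)
   - 3 * (\sum_k d i k * g k j ^+ 2) - 3 * (\sum_k d j k * g i k ^+ 2)
   + 9 * (\sum_k d i k * d j k)).
  rewrite !mulr_sumr -!sumrB -big_split; apply: eq_bigr => k _.
  by rewrite /= !hg (dC k j); ring.
by rewrite (tensor_design gC gd gn gs) !dS (dC j i); ring.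
Qed.

End Hadamard9.

Lemma card_pred_count (T : finType) (U : Type) (f : T -> U) (P : pred U) :
  #|[set k | P (f k)]| = count P [seq f k | k <- enum T].
Proof. by rewrite cardsE cardE count_map -size_filter enumT. Qed.

Lemma card_xor (T : finType) (A B : {set T}) :
  (#|[set x | (x \in A) (+) (x \in B)]| + 2 * #|A :&: B| = #|A| + #|B|)%N.
Proof.
rewrite -(cardsID A [set x | _]).
have -> : [set x | (x \in A) (+) (x \in B)] :&: A = A :\: B.
  by apply/setP => x; rewrite !inE; do 2!case: (x \in _).
have -> : [set x | (x \in A) (+) (x \in B)] :\: A = B :\: A.
  by apply/setP => x; rewrite !inE; do 2!case: (x \in _).
rewrite -[in RHS](cardsID B A) -[in RHS](cardsID A B) (setIC B A); lia.
Qed.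

(** * Primitive cube roots of unity and the triple products of [h] *)

Section CubeRoots.
Variables (C : numClosedFieldType) (w : C).
Hypothesis w0 : w ^+ 2 + w + 1 = 0.

Lemma croot_cube : w ^+ 3 = 1.
Proof.
transitivity (w ^+ 3 - (w - 1) * (w ^+ 2 + w + 1)); last by ring.
by rewrite w0 mulr0 subr0.
Qed.

Lemma croot_neq0 : w != 0.
Proof. by apply: contraPneq w0 => ->; rewrite expr0n !add0r => /eqP; rewrite oner_eq0. Qed.

Lemma croot_neq1 : w != 1.
Proof.
apply: contraPneq w0 => ->; rewrite expr1n => /eqP.
have -> : 1 + 1 + 1 = 3 :> C by ring.
by rewrite pnatr_eq0.
Qed.

Lemma croot_sqr_neq1 : w ^+ 2 != 1.
Proof.
apply: contraNneq croot_neq1 => w2; apply/eqP.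
by rewrite -croot_cube exprS w2 mulr1.
Qed.

Lemma croot_sqr_neq : w ^+ 2 != w.
Proof. by rewrite expr2 -{3}[w]mulr1 (inj_eq (mulfI croot_neq0)) croot_neq1. Qed.

Lemma conj_croot : w^* = w ^+ 2.
Proof.
have w1 : `|w| = 1.
  by apply/eqP; rewrite -(@pexpr_eq1 _ _ 3) // -normrX croot_cube normr1.
rewrite conj_unimodular //; apply: (mulfI croot_neq0).
by rewrite divff ?croot_neq0 // -exprS croot_cube.
Qed.

Lemma count_cube_roots3 c x : c != 0 ->
  count_mem x [:: c; c * w; c * w ^+ 2] = (x ^+ 3 == c ^+ 3) :> nat.
Proof.
move=> c0; rewrite /= addn0.
have cE a b : (c * a == c * b) = (a == b) by apply: inj_eq; apply: mulfI.
have E1 : (c == c * w) = false by rewrite -{1}[c]mulr1 cE eq_sym (negPf croot_neq1).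
have E2 : (c == c * w ^+ 2) = false by rewrite -{1}[c]mulr1 cE eq_sym (negPf croot_sqr_neq1).
have xE : x ^+ 3 - c ^+ 3 = (x - c) * ((x - c * w) * (x - c * w ^+ 2)).
  transitivity ((x - c) * ((x - c * w) * (x - c * w ^+ 2)) +
     c * (w ^+ 2 + w + 1) * (x ^+ 2 - c * w * x + c ^+ 2 * (w - 1))); first by ring.
  by rewrite w0; ring.
rewrite -[x ^+ 3 == _]subr_eq0 xE !mulf_eq0 !subr_eq0 !(eq_sym x).
case: (eqVneq c x) => [<-|_].
  by rewrite ![c * _ == c]eq_sym E1 E2.
case: (eqVneq (c * w) x) => [<-|_] //=.
by rewrite cE (negPf croot_sqr_neq).
Qed.

Lemma count_cube_roots c x : c != 0 ->
  count_mem x (cube_roots w c) = (2 * (x ^+ 3 == 1)%R + (x ^+ 3 == c ^+ 3)%R)%N.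
Proof.
move=> c0; have := count_cube_roots3 x c0; have := count_cube_roots3 x (oner_neq0 C).
rewrite /cube_roots /= expr1n !mul1r !mulr1 => <- <-.
by rewrite mul2n -addnn !addn0 !addnA.
Qed.

Lemma cube_root_cases x : x ^+ 3 = 1 -> [\/ x = 1, x = w | x = w ^+ 2].
Proof.
move=> x3; have := count_cube_roots3 x (oner_neq0 C).
rewrite x3 expr1n eqxx !mul1r /=.
case: eqP => [<-|_]; first by constructor 1.
case: eqP => [<-|_]; first by constructor 2.
by case: eqP => [<-|_]; first by constructor 3.
Qed.

Section Phases.
Variable h : 'I_9 -> 'I_9 -> C.
Hypothesis hadh : sa_hadamard9 h.

(** The triple product, or Bargmann invariant: conjugating [h] by a unitary diagonal matrix does not
    change it. *)
Definition phase i j k := h i j * h j k * h k i.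

Lemma phase_rot i j k : phase i j k = phase j k i.
Proof. by rewrite /phase; ring. Qed.

Lemma phase_conj i j k : phase j i k = (phase i j k)^*.
Proof.
have [hC _ _ _] := hadh; rewrite /phase !rmorphM /= -!hC; ring.
Qed.

Lemma norm_phase i j k : `|phase i j k| = 1.
Proof. by have [_ h1 _ _] := hadh; rewrite /phase !normrM !h1 !mulr1. Qed.

Lemma entry_mul_sym i j : h i j * h j i = 1.
Proof. by have [hC h1 _ _] := hadh; rewrite (hC i j) -normCK h1 expr1n. Qed.

Lemma phase_left i j : phase i j i = 1.
Proof. by have [_ _ hd _] := hadh; rewrite /phase hd mulr1 entry_mul_sym. Qed.

Lemma phase_right i j : phase i j j = 1.
Proof. by have [_ _ hd _] := hadh; rewrite /phase hd mulr1 entry_mul_sym. Qed.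

(** Each edge from [l] is traversed once in both directions, and [h l i * h i l = 1]. *)
Lemma phase_cocycle l i j k : phase i j k = phase l i j * phase l j k * phase l k i.
Proof.
rewrite /phase.
transitivity (h i j * h j k * h k i * (h l i * h i l) * (h l j * h j l) * (h l k * h k l)).
  by rewrite !entry_mul_sym; ring.
by ring.
Qed.

(** The power sums of exponents 1, 2 and 4 vanish by orthogonality in [h], its entrywise square and
    its entrywise fourth power. The value 1 occurs at [k = i] and at [k = j]. *)
Lemma phase_perm i j : i != j ->
  exists2 c, c != 0 & perm_eq [seq phase i j k | k <- enum 'I_9] (cube_roots w c).
Proof.
move=> ij.
have p0 m : m \in [:: 1; 2; 4]%N -> \sum_k phase i j k ^+ m = 0.
  move=> m124; have [f [_ _ _ f9] fE] : exists2 f, sa_hadamard9 f & forall a b, h a b ^+ m = f a b.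
    have h2 := sa_hadamard9_sq hadh; have h4 := sa_hadamard9_sq h2.
    move: m124; rewrite !inE => /or3P [] /eqP ->; [exists h|exists (fun a b => h a b ^+ 2)|] => //.
    by eexists; first exact: h4; move=> a b /=; rewrite -exprM.
  transitivity (h i j ^+ m * \sum_k f j k * f k i).
    by rewrite mulr_sumr; apply: eq_bigr => k _; rewrite /phase !exprMn !fE; ring.
  by rewrite f9 eq_sym (negPf ij) !mulr0.
set s := [seq _ | _ <- _].
have s1 : {in s, forall z, `|z| = 1} by move=> _ /mapP [k _ ->]; exact: norm_phase.
have [||m /p0 m0|c sc] := @perm_cube_roots C w s w0 _ s1.
- by rewrite size_map size_enum_ord.
- rewrite -card_pred_count; apply: (@leq_trans #|[set i; j]|); first by rewrite cards2 ij.
  by apply/subset_leq_card/subsetP => k; rewrite !inE => /orP [] /eqP ->;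
    rewrite ?phase_left ?phase_right.
- by rewrite -[RHS]m0 big_map big_enum.
exists c => //; apply: unimodular_neq0; apply: s1.
by rewrite (perm_mem sc) /cube_roots /= !inE !mulr1 eqxx !orbT.
Qed.

Section Flat.
Variables i j k : 'I_9.
Hypotheses (ij : i != j) (ki : k != i) (kj : k != j) (f1 : phase i j k = 1).

Let flat_sub : [set i; j; k] \subset [set l | phase i j l == 1].
Proof.
by apply/subsetP => l; rewrite !inE => /orP [/orP []|] /eqP ->;
  rewrite ?phase_left ?phase_right ?f1.
Qed.

Let card_ijk : #|[set i; j; k]| = 3.
Proof. by rewrite setUC cardsU1 !inE cards2 negb_or ij ki kj. Qed.

(** The value 1 occurs at [i], [j] and [k], but only twice in [cube_roots w c] unless
    [c ^+ 3 = 1]. *)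
Let flat_perm : exists c, [/\ c != 0, c ^+ 3 = 1
  & perm_eq [seq phase i j l | l <- enum 'I_9] (cube_roots w c)].
Proof.
have [c c0 fc] := phase_perm ij; exists c; split=> //.
have := subset_leq_card flat_sub.
rewrite card_ijk (card_pred_count _ (pred1 1)) (seq.permP fc) count_cube_roots // expr1n eqxx.
by rewrite eq_sym; case: eqP.
Qed.

Lemma card_flat x : x ^+ 3 = 1 -> #|[set l | phase i j l == x]| = 3.
Proof.
move=> x3; have [c [c0 c3 fc]] := flat_perm.
by rewrite (card_pred_count _ (pred1 x)) (seq.permP fc) count_cube_roots // x3 c3 eqxx.
Qed.

Lemma flat_cube l : phase i j l ^+ 3 = 1.
Proof.
have [c [c0 c3 fc]] := flat_perm.
have : phase i j l \in cube_roots w c by rewrite -(perm_mem fc) map_f ?mem_enum.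
by rewrite -has_pred1 has_count count_cube_roots // c3; case: eqP.
Qed.

Lemma flat_eq1 l : phase i j l = 1 -> [|| l == i, l == j | l == k].
Proof.
move=> l1; have : [set i; j; k] == [set l | phase i j l == 1].
  by rewrite eqEcard flat_sub card_flat ?expr1n // card_ijk.
by move=> /eqP /setP /(_ l); rewrite !inE l1 eqxx orbA.
Qed.

End Flat.

(** Now 1 occurs only at [i] and [j], so [c ^+ 3 != 1]: the cubes are 1 six times and [v = c ^+ 3]
    three times. *)
Lemma phase_perm_cubes i j : i != j ->
  (forall k, k != i -> k != j -> phase i j k != 1) ->
  exists v, [/\ v != 1, forall k, phase i j k ^+ 3 != 1 -> phase i j k ^+ 3 = v
    & #|[set k | phase i j k ^+ 3 != 1]| = 3].
Proof.
move=> ij fn; have [c c0 fc] := phase_perm ij.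
have c3 : c ^+ 3 != 1.
  have : #|[set l | phase i j l == 1]| = 2.
    rewrite -[RHS]/(true.+1) -ij -cards2; congr #|pred_of_set _|; apply/setP => k; rewrite !inE.
    have [->|ki] := eqVneq k i; first by rewrite phase_left eqxx.
    have [->|kj] := eqVneq k j; first by rewrite phase_right eqxx.
    by rewrite (negPf (fn _ _ _)).
  rewrite (card_pred_count _ (pred1 1)) (seq.permP fc) count_cube_roots // expr1n eqxx.
  by rewrite eq_sym; case: eqP.
exists (c ^+ 3); split=> //.
- move=> k; have : phase i j k \in cube_roots w c.
    by rewrite -(perm_mem fc) map_f ?mem_enum.
  rewrite -has_pred1 has_count count_cube_roots //.
  by case: eqP => //= _; case: eqP.
- rewrite (card_pred_count _ (fun x => x ^+ 3 != 1)) (seq.permP fc) /=.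
  have E1 a : (a * w) ^+ 3 = a ^+ 3 by rewrite exprMn croot_cube mulr1.
  have E2 a : (a * w ^+ 2) ^+ 3 = a ^+ 3 by rewrite expr2 mulrA !E1.
  by rewrite !E1 !E2 !mulr1 expr1n !eqxx c3.
Qed.

(* Otherwise all [phase o j l ^+ 3] and [phase o k l ^+ 3] lie in a common [{1, v}]
   for suitable [j] and [k], each taking the value [v] three times, with a common
   such [l].  So the number of [l] where they differ is even and at most 4, while
   [phase_perm_cubes] at the pair [(j, k)] forces it to be 3 or 6. *)
Lemma exists_flat_phase : exists i j k, [/\ i != j, k != i, k != j & phase i j k = 1].
Proof.
pose flat := [exists t : 'I_9 * ('I_9 * 'I_9),
  [&& t.1 != t.2.1, t.2.2 != t.1, t.2.2 != t.2.1 & phase t.1 t.2.1 t.2.2 == 1]].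
have [/existsP [[i [j k]] /= /and4P [ij ki kj /eqP fe]]|nf] := boolP flat.
  by exists i, j, k.
exfalso.
have fn i j k : i != j -> k != i -> k != j -> phase i j k != 1.
  move=> ij ki kj; apply: contraNneq nf => f1.
  by apply/existsP; exists (i, (j, k)); rewrite /= ij ki kj f1 eqxx.
have [o [i oi]] : exists o i : 'I_9, o != i by exists ord0, ord_max.
have cub a b := @phase_perm_cubes a b.
have [u [u1 uE U3]] := cub _ _ oi (fun k => @fn o i k oi).
have [j [k [jU kU jk]]] : exists j k, [/\ phase o i j ^+ 3 != 1, phase o i k ^+ 3 != 1 & j != k].
  have /card_gt1P [j [k [jU kU jk]]] : (1 < #|[set k | phase o i k ^+ 3 != 1%R]|)%N by rewrite U3.
  by exists j, k; rewrite !inE in jU kU.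
have oj : o != j by apply: contraNneq jU => <-; rewrite phase_left expr1n.
have ok : o != k by apply: contraNneq kU => <-; rewrite phase_left expr1n.
have [v [v1 vE V3]] := cub _ _ oj (fun k => @fn o j k oj).
have [v' [_ vE' V3']] := cub _ _ ok (fun l => @fn o k l ok).
have [_ [_ _ T3]] := cub _ _ jk (fun l => @fn j k l jk).
pose f l := phase o j l ^+ 3; pose g l := phase o k l ^+ 3.
have swap a b c : phase a b c ^+ 3 = (phase a c b ^+ 3)^*.
  by rewrite phase_rot phase_conj -phase_rot rmorphXn.
have conj_eq1 (z : C) : (z^* == 1) = (z == 1).
  by rewrite -{1}(rmorph1 Num.conj) (inj_eq (can_inj conjCK)).
have fi1 : f i != 1 by rewrite /f swap conj_eq1.
have gi1 : g i != 1 by rewrite /g swap conj_eq1.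
(* At [i] both [f] and [g] equal the conjugate of [u], so their nontrivial values coincide. *)
have {vE'}vE' l : g l != 1 -> g l = v.
  move=> /vE' gl; rewrite /g gl -(vE' _ gi1) -(vE _ fi1).
  by rewrite (swap o k i) (swap o j i) (uE _ kU) (uE _ jU).
pose A := [set l | f l != 1]; pose B := [set l | g l != 1].
have fE l : f l = if l \in A then v else 1 by rewrite inE; have [//|/vE] := eqVneq (f l) 1.
have gE l : g l = if l \in B then v else 1 by rewrite inE; have [//|/vE'] := eqVneq (g l) 1.
have vV : v * v^* = 1 by rewrite -(vE _ fi1) -normCK normrX norm_phase !expr1n.
have fgE l : phase j k l ^+ 3 = f k * g l * (f l)^*.
  by rewrite /f /g -swap -!exprMn -phase_cocycle.
pose S := [set l | (l \in A) (+) (l \in B)].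
have cardS : (#|S| + 2 * #|A :&: B| = 6)%N by rewrite card_xor V3 V3'.
have AB0 : (0 < #|A :&: B|)%N by apply/card_gt0P; exists i; rewrite !inE fi1.
have [fk|fk] := eqVneq (f k) 1.
  suff TS : [set l | phase j k l ^+ 3 != 1] = S.
    by move: T3 cardS; rewrite TS => ->; move: #|A :&: B| => a; clear; lia.
  apply/setP => l; rewrite inE fgE fk mul1r fE gE [in RHS]inE.
  by case: (l \in A); case: (l \in B); rewrite ?vV ?conjC1 ?mulr1 ?mul1r ?conj_eq1 ?eqxx.
have fkv : f k = v := vE _ fk.
(* [g j] is the conjugate of [f k = v], hence nontrivial, hence equal to [v]: so [v] is real. *)
have v2 : v * v = 1.
  have gj : g j = v^* by rewrite /g swap -/(f k) fkv.
  have : g j = v by apply: vE'; rewrite gj conj_eq1.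
  by rewrite gj => {2}<-.
(* The extra factor [f k = v] makes the cube trivial exactly where [f] and [g] differ. So [S] would
   have 6 elements, which forces [A] and [B] to be disjoint. *)
suff TS : [set l | phase j k l ^+ 3 != 1] = ~: S.
  move: T3 cardS (cardsC S) AB0; rewrite TS card_ord => ->.
  by move: #|A :&: B| #|S| => a b; clear; lia.
have vc : v^* = v.
  apply: (mulfI (_ : v != 0)); last by rewrite vV.
  by apply: contraNneq (oner_neq0 C) => v0; rewrite -v2 v0 mul0r.
apply/setP => l; rewrite inE fgE fkv fE gE !inE -/A -/B.
by case: (f l == 1); case: (g l == 1); rewrite /= ?vc ?conjC1 ?v2 ?mulr1 ?v2 ?mul1r ?v1 ?eqxx.
Qed.
End Phases.
End CubeRoots.

Lemma sum_set3 (I : finType) (V : nmodType) (x y z : I) (f : I -> V) :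
  x != y -> x != z -> y != z -> \sum_(k in [set x; y; z]) f k = f x + f y + f z.
Proof.
move=> xy xz yz.
rewrite setUC big_setU1 ?inE ?negb_or ?[z == _]eq_sym ?xz //=.
by rewrite big_setU1 ?inE //= big_set1 addrC.
Qed.

(** * Blocks of a matrix normalized along row [o] *)

Section Blocks.
Variables (C : numClosedFieldType) (h : 'I_9 -> 'I_9 -> C).
Hypothesis hadh : sa_hadamard9 h.
Variables (o p q : 'I_9).
Hypothesis h_o : forall x, h o x = 1.
Hypothesis hpq : h p q = 1.

Let hC i j : h j i = (h i j)^*. Proof. by have [] := hadh. Qed.
Let hd i : h i i = 1. Proof. by have [] := hadh. Qed.
Let h_xo x : h x o = 1. Proof. by rewrite hC h_o conjC1. Qed.
Let h_qp : h q p = 1. Proof. by rewrite hC hpq conjC1. Qed.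

(** * One diagonal block, for [t] either [w] or its square (with [A] and [B] exchanged) *)

Section Block.
Variables (t : C) (A B : {set 'I_9}).
Hypotheses (t0 : t ^+ 2 + t + 1 = 0) (A3 : #|A| = 3) (B3 : #|B| = 3).
Hypotheses (hpA : forall k, k \in A -> h p k = t) (hqA : forall k, k \in A -> h q k = t ^+ 2).
Hypothesis hpB : forall k, k \in B -> h p k = t ^+ 2.
(* That [{o, p, q}], [A] and [B] partition the indices is only used via sums. *)
Hypothesis sumE : forall f : 'I_9 -> C,
  \sum_k f k = f o + f p + f q + \sum_(k in A) f k + \sum_(k in B) f k.

Let conj_t2 : (t ^+ 2)^* = t.
Proof. by rewrite -(conj_croot t0) conjCK. Qed.

Let h_xp x : x \in A -> h x p = t ^+ 2.
Proof. by move=> xA; rewrite hC hpA ?(conj_croot t0). Qed.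

Let h_xq x : x \in A -> h x q = t.
Proof. by move=> xA; rewrite hC hqA. Qed.

Let sum_orth x y : x != y -> \sum_k h x k * h k y = 0.
Proof. by have [_ _ _ ->] := hadh => /negPf ->; rewrite mulr0. Qed.

(** Let [X] and [Y] be the sums of row [x] over [A] and [B]. Orthogonality to rows [o] and [p] gives
    [X + Y = 0] and [t^2 X + t Y = 0], hence [t (t - 1) X = 0]. *)
Lemma block_sum0 x : x \in A -> \sum_(k in A) h x k = 0.
Proof.
move=> xA; have xo : x != o.
  by apply: contraNneq (croot_neq1 t0) => xo; rewrite -(hpA xA) xo h_xo.
have xp : x != p.
  by apply: contraNneq (croot_neq1 t0) => xp; rewrite -(hpA xA) xp hd.
set X := \sum_(k in A) _; set Y := \sum_(k in B) h x k.
have E1 : 1 + t ^+ 2 + t + X + Y = 0.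
  rewrite -(sum_orth xo) sumE !h_xo (h_xp xA) (h_xq xA) !mulr1; congr (_ + _ + _).
    by apply: eq_bigr => k _; rewrite h_xo mulr1.
  by apply: eq_bigr => k _; rewrite h_xo mulr1.
have E2 : 1 + t ^+ 2 + t + t ^+ 2 * X + t * Y = 0.
  rewrite -(sum_orth xp) sumE h_xo (h_xp xA) (h_xq xA) h_o hd h_qp !mulr1 !mulr_sumr.
  congr (_ + _ + _); apply: eq_bigr => k kAB; first by rewrite h_xp // mulrC.
  by rewrite (hC p) hpB // conj_t2 mulrC.
have t1 : t - 1 != 0 by rewrite subr_eq0 (croot_neq1 t0).
apply: (mulfI (mulf_neq0 (croot_neq0 t0) t1)); rewrite mulr0.
transitivity (1 + t ^+ 2 + t + t ^+ 2 * X + t * Y - t * (1 + t ^+ 2 + t + X + Y)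
  + (t - 1) * (t ^+ 2 + t + 1)); first by ring.
by rewrite E1 E2 t0; ring.
Qed.

(** By [block_sum0], a row of the block consists of 1 and two unimodular numbers of sum -1, which
    must be [t] and [t^2]. Exchanging [y] and [z] fixes their order. *)
Lemma block_cycle : exists x y z,
  [/\ A = [set x; y; z], [&& x != y, x != z & y != z], h x y = t ^+ 2, h x z = t & h y z = t ^+ 2].
Proof.
have [x [y [z [AE xy xz yz]]]] : exists x y z, [/\ A = [set x; y; z], x != y, x != z & y != z].
  have : uniq (enum A) := enum_uniq _; have := cardE A; rewrite A3.
  case E : (enum A) => [|x [|y [|z []]]] //= _; rewrite !inE negb_or.
  case/andP => /andP [xy xz] /andP [yz _]; exists x, y, z; split=> //.
  by apply/setP => k; rewrite -mem_enum E !inE orbA.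
have [xA yA] : x \in A /\ y \in A by rewrite AE !inE !eqxx !orbT.
have := block_sum0 xA; have := block_sum0 yA.
rewrite AE !sum_set3 // !hd => Sy Sx.
have t2E : t ^+ 2 = - 1 - t by rewrite -[RHS]addr0 -t0; ring.
have nxy : h x y * (h x y)^* = 1 by rewrite -hC entry_mul_sym.
have nxz : h x z * (h x z)^* = 1 by rewrite -hC entry_mul_sym.
have xzE : h x z = - 1 - h x y by rewrite -[RHS]addr0 -Sx; ring.
have yzE : h y z = - 1 - (h x y)^* by rewrite -hC -[RHS]addr0 -Sy; ring.
have /eqP : (h x y - t) * (h x y - t ^+ 2) = 0.
  move: nxz; rewrite xzE rmorphB rmorphN1 => nxz.
  set u := h x y in nxy nxz *; set v := u^* in nxy nxz.
  (* The conditions [u v = 1] and [(1 + u) (1 + v) = 1] combine to [u^2 + u + 1 = 0]. *)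
  transitivity (u * ((- 1 - u) * (- 1 - v) - 1) + (1 + u) * (1 - u * v)
    + (t - 1 - u) * (t ^+ 2 + t + 1)); first by ring.
  by rewrite nxz nxy t0; ring.
rewrite mulf_eq0 !subr_eq0 => /orP [] /eqP xyE; last first.
  exists x, y, z; split=> //; first by rewrite xy xz yz.
    by rewrite xzE xyE t2E; ring.
  by rewrite yzE xyE conj_t2 t2E.
exists x, z, y; split.
- by rewrite -!setUA [[set y] :|: _]setUC.
- by rewrite xy xz eq_sym yz.
- by rewrite xzE xyE t2E.
- by [].
- by rewrite hC yzE xyE (conj_croot t0) rmorphB rmorphN1 /= conj_t2 t2E; ring.
Qed.

(* Orthogonality of the rows [x] and [y] leaves three unimodular terms, over [B],
   whose sum has modulus 3; hence they are equal. *)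
Lemma block_shift c x y k : c ^+ 2 + c + 1 = 0 -> x \in A -> y \in A -> x != y ->
  h x y = c -> \sum_(l in A) h x l * h l y = 3 * c -> k \in B -> h y k = c * h x k.
Proof.
move=> c0 xA yA xy xyE SA kB.
have c3 := croot_cube c0; have c2E : c ^+ 2 = - 1 - c by rewrite -[RHS]addr0 -c0; ring.
have cn : `|c| = 1 by have [_ h1 _ _] := hadh; rewrite -xyE h1.
(* The indices [o], [p] and [q] contribute [1 + t^3 + t^3 = 3], so the sum over [B] is
   [- 3 - 3 c]. *)
have SB : \sum_(l in B) h x l * h l y = 3 * c ^+ 2.
  have := sum_orth xy; rewrite sumE SA h_xo h_o.
  rewrite (h_xp xA) (h_xq xA) (hpA yA) (hqA yA) -exprSr -exprS (croot_cube t0) => S0.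
  by rewrite c2E -[RHS]addr0 -[in RHS]S0; ring.
have [u uE] : exists u, forall l, l \in B -> h x l * h l y = u.
  have [|l lB|u _ uE] := @normC_sum_eq1 C _ (fun l => l \in B) (fun l => h x l * h l y).
  - rewrite SB normrM normrX cn expr1n normr_nat mulr1.
    have [_ h1 _ _] := hadh.
    under eq_bigr => l _ do rewrite normrM !h1 mulr1.
    by rewrite sumr_const B3.
  - by have [_ h1 _ _] := hadh; rewrite normrM !h1 mulr1.
  - by exists u.
have uc : u = c ^+ 2.
  apply: (@mulfI _ 3); first by rewrite pnatr_eq0.
  by rewrite -SB (eq_bigr (fun _ => u)) // sumr_const B3 mulr_natl.
transitivity (c * (h x k * h k y) * h y k); first by rewrite (uE _ kB) uc -exprS c3 mul1r.
by rewrite -!mulrA entry_mul_sym // mulr1.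
Qed.
End Block.
End Blocks.

(** * The first three rows of the normalized matrix *)

Section Partition.
Variables (C : numClosedFieldType) (w : C) (h : 'I_9 -> 'I_9 -> C).
Hypotheses (w0 : w ^+ 2 + w + 1 = 0) (hadh : sa_hadamard9 h).
Variables (o p q : 'I_9).
Hypotheses (h_o : forall x, h o x = 1) (op : o != p) (oq : o != q) (pq : p != q).
Hypothesis hpq : h p q = 1.

Let hC i j : h j i = (h i j)^*. Proof. by have [] := hadh. Qed.
Let hd i : h i i = 1. Proof. by have [] := hadh. Qed.
Let h_xo x : h x o = 1. Proof. by rewrite hC h_o conjC1. Qed.
Let h_qp : h q p = 1. Proof. by rewrite hC hpq conjC1. Qed.

(** The results on flat triples apply to the pairs [(o, p)], [(o, q)] and [(p, q)]. Outside [o],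
    [p], [q] they make [h p k], [h q k] and their quotient cube roots of unity other than 1, so
    [h p k] and [h q k] are [w] and [w ^+ 2] in some order. *)
Lemma flat_partition : exists A B : {set 'I_9},
  [/\ #|A| = 3, #|B| = 3, forall k, k \in A -> h p k = w /\ h q k = w ^+ 2,
      forall k, k \in B -> h p k = w ^+ 2 /\ h q k = w
    & forall f : 'I_9 -> C,
        \sum_k f k = f o + f p + f q + \sum_(k in A) f k + \sum_(k in B) f k].
Proof.
have [qo qp po] : [/\ q != o, q != p & p != o] by split; rewrite eq_sym.
have phE l k : phase h o l k = h l k by rewrite /phase h_o h_xo mul1r mulr1.
have fp : phase h o p q = 1 by rewrite phE.
have fq : phase h o q p = 1 by rewrite phE.
have fpq : phase h p q o = 1 by rewrite -phase_rot.
have w3 := croot_cube w0.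
have w2_3 : (w ^+ 2) ^+ 3 = 1 by rewrite -exprM mulnC exprM w3 expr1n.
have pE k := cube_root_cases w0 (flat_cube w0 hadh op qo qp fp k).
have qE k := cube_root_cases w0 (flat_cube w0 hadh oq po pq fq k).
have p1 k := flat_eq1 w0 hadh op qo qp fp (l := k).
have q1 k := flat_eq1 w0 hadh oq po pq fq (l := k).
have pq1 k := flat_eq1 w0 hadh pq op oq fpq (l := k).
rewrite /= in pE qE.
have inO k : (k \in [set o; p; q]) = (h p k == 1).
  apply/idP/eqP; first by rewrite !inE => /orP [/orP []|] /eqP ->.
  by rewrite -phE => /p1; rewrite !inE orbA.
have pqE k : phase h p q k = h q k * (h p k)^* by rewrite /phase hpq mul1r -hC.
have nO k : h p k != 1 -> [/\ h q k != 1 & h q k * (h p k)^* != 1].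
  rewrite -inO !inE => kO; split; apply: contraNneq kO.
    by rewrite -phE => /q1 /or3P [] ->; rewrite ?orbT.
  by rewrite -pqE => /pq1 /or3P [] ->; rewrite ?orbT.
exists [set k | h p k == w], [set k | h p k == w ^+ 2]; split.
- by rewrite -(card_flat w0 hadh op qo qp fp w3); apply: eq_card => k; rewrite !inE phE.
- by rewrite -(card_flat w0 hadh op qo qp fp w2_3); apply: eq_card => k; rewrite !inE phE.
- move=> k; rewrite inE => /eqP pk; split=> //.
  have [|] := nO k; rewrite pk ?(croot_neq1 w0) // (conj_croot w0) => q_1 q_w.
  have := qE k; rewrite phE => -[] // qk; rewrite qk ?eqxx // in q_1 q_w.
  by rewrite -exprS w3 eqxx in q_w.
- move=> k; rewrite inE => /eqP pk; split=> //.
  have [|] := nO k; rewrite pk ?(croot_sqr_neq1 w0) // -(conj_croot w0) conjCK => q_1 q_w.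
  have := qE k; rewrite phE => -[] // qk; rewrite qk ?eqxx // in q_1 q_w.
  by rewrite -exprSr w3 eqxx in q_w.
- move=> f; rewrite (bigID (fun k => k \in [set o; p; q])) /= sum_set3 // -[RHS]addrA.
  congr (_ + _); rewrite (bigID (fun k => h p k == w)) /=.
  congr (_ + _); apply: eq_bigl => k; rewrite inO inE.
    by case: eqP => // ->; rewrite eq_sym (negPf (croot_neq1 w0)).
  have := pE k; rewrite phE => -[] ->.
  + by rewrite eqxx [1 == w ^+ 2]eq_sym (negPf (croot_sqr_neq1 w0)).
  + by rewrite eqxx andbF [w == w ^+ 2]eq_sym (negPf (croot_sqr_neq w0)).
  + by rewrite eqxx (negPf (croot_sqr_neq1 w0)) (negPf (croot_sqr_neq w0)).
Qed.
End Partition.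

(** * Identification with the matrix [H9 a] *)

Section NormalForm.
Variable R : realType.
Local Notation w := (omega R).
Local Notation C := (R[i])%C.

Lemma omega_root : w ^+ 2 + w + 1 = 0.
Proof.
have s3 : Num.sqrt 3 * Num.sqrt 3 = 3 :> R by rewrite -expr2 sqr_sqrtr ?ler0n.
rewrite /omega expr2; apply/eqP; rewrite eq_complex /=; apply/andP; split; apply/eqP.
  transitivity ((3 - Num.sqrt 3 * Num.sqrt 3) / 4 : R); first by field.
  by rewrite s3 subrr mul0r.
by field.
Qed.

Section Ordered.
Variables (h : 'I_9 -> 'I_9 -> C) (a : C) (x0 x1 x2 x3 x4 x5 x6 x7 x8 : 'I_9).
Hypothesis hadh : sa_hadamard9 h.
Hypotheses (h_o : forall x, h x0 x = 1) (E12 : h x1 x2 = 1).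
Hypotheses (E13 : h x1 x3 = w) (E14 : h x1 x4 = w) (E15 : h x1 x5 = w).
Hypotheses (E16 : h x1 x6 = w ^+ 2) (E17 : h x1 x7 = w ^+ 2) (E18 : h x1 x8 = w ^+ 2).
Hypotheses (E23 : h x2 x3 = w ^+ 2) (E24 : h x2 x4 = w ^+ 2) (E25 : h x2 x5 = w ^+ 2).
Hypotheses (E26 : h x2 x6 = w) (E27 : h x2 x7 = w) (E28 : h x2 x8 = w).
Hypotheses (E34 : h x3 x4 = w ^+ 2) (E35 : h x3 x5 = w) (E45 : h x4 x5 = w ^+ 2).
Hypotheses (E36 : h x3 x6 = a) (E37 : h x3 x7 = a * w ^+ 2) (E38 : h x3 x8 = a * w).
Hypotheses (E46 : h x4 x6 = a * w ^+ 2) (E47 : h x4 x7 = a * w) (E48 : h x4 x8 = a).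
Hypotheses (E56 : h x5 x6 = a * w) (E57 : h x5 x7 = a) (E58 : h x5 x8 = a * w ^+ 2).
Hypotheses (E67 : h x6 x7 = w) (E68 : h x6 x8 = w ^+ 2) (E78 : h x7 x8 = w).

Let s := [:: x0; x1; x2; x3; x4; x5; x6; x7; x8].

(** The hypotheses list the upper triangle; the lower one follows because both sides are
    self-adjoint. *)
Lemma H9_entries (i j : 'I_9) : H9 a i j = h (nth x0 s i) (nth x0 s j).
Proof.
have [hC _ hd _] := hadh; have conj_w := conj_croot omega_root.
have conj_w2 : (w ^+ 2)^* = w by rewrite -conj_w conjCK.
have entries := (h_o, hd, E12, E13, E14, E15, E16, E17, E18, E23, E24, E25, E26, E27, E28,
  E34, E35, E45, (E36, E37, E38), (E46, E47, E48), (E56, E57, E58), (E67, E68, E78)).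
have up (k l : 'I_9) : (k <= l)%N -> H9 a k l = h (nth x0 s k) (nth x0 s l).
  rewrite mxE; case: k l => [k lk] [l ll] /=.
  do 9?[case: k lk => [|k] lk //]; do 9?[case: l ll => [|l] ll //];
    by move=> _ /=; rewrite entries.
have cM (x y : C) : (x * y)^* = x^* * y^* := rmorphM _ x y.
have w4 : w ^+ 2 * w ^+ 2 = w by rewrite -exprD exprS (croot_cube omega_root) mulr1.
have low (k l : 'I_9) : H9 a l k = (H9 a k l)^*.
  rewrite !mxE; case: k l => [k lk] [l ll] /=.
  do 9?[case: k lk => [|k] lk //]; do 9?[case: l ll => [|l] ll //];
    by rewrite /= ?conj_w2 ?conj_w ?cM ?conjCK ?conj_w2 ?conj_w ?conjC1 ?w4.
have [/up //|/ltnW ji] := leqP i j.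
by rewrite low up // -hC.
Qed.
End Ordered.

(** Once [block_cycle] has ordered [A] and [B], the corner [a = h x3 x6] determines the block
    between them: by [block_shift], each row and each column is [w ^+ 2] times the preceding one. *)
Lemma exists_ordering (h : 'I_9 -> 'I_9 -> C) (o p q : 'I_9) :
  sa_hadamard9 h -> (forall x, h o x = 1) -> o != p -> o != q -> p != q -> h p q = 1 ->
  exists a (s : {perm 'I_9}), `|a| = 1 /\ forall i j, H9 a i j = h (s i) (s j).
Proof.
move=> hadh h_o op oq pq hpq; have w0 := omega_root; have w3 := croot_cube w0.
have w2_w2 : (w ^+ 2) ^+ 2 = w by rewrite -exprM (exprS w 3) w3 mulr1.
have w2_0 : (w ^+ 2) ^+ 2 + w ^+ 2 + 1 = 0 by rewrite w2_w2 (addrC w).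
have [A [B [A3 B3 hA hB sumE]]] := flat_partition w0 hadh h_o op oq pq hpq.
have hpA k (kA : k \in A) := (hA k kA).1; have hqA k (kA : k \in A) := (hA k kA).2.
have hpB k (kB : k \in B) := (hB k kB).1; have hqB k (kB : k \in B) := (hB k kB).2.
have sumE' (f : 'I_9 -> C) :
    \sum_k f k = f o + f p + f q + \sum_(k in B) f k + \sum_(k in A) f k.
  by rewrite sumE addrAC.
have hpA' k (kA : k \in A) : h p k = (w ^+ 2) ^+ 2 by rewrite w2_w2 hpA.
have hqB' k (kB : k \in B) : h q k = (w ^+ 2) ^+ 2 by rewrite w2_w2 hqB.
have [x3 [x4 [x5 [AE /and3P [n34 n35 n45] E34 E35 E45]]]] :=
  block_cycle hadh h_o hpq w0 A3 hpA hqA hpB sumE.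
have [x6 [x7 [x8 [BE /and3P [n67 n68 n78] E67 E68 E78]]]] :=
  block_cycle hadh h_o hpq w2_0 B3 hpB hqB' hpA' sumE'.
rewrite w2_w2 in E67 E78.
have [hC h1 hd _] := hadh.
have [A3' A4 A5] : [/\ x3 \in A, x4 \in A & x5 \in A] by rewrite AE !inE !eqxx !orbT.
have [B6 B7 B8] : [/\ x6 \in B, x7 \in B & x8 \in B] by rewrite BE !inE !eqxx !orbT.
have E54 : h x5 x4 = w by rewrite hC E45 -(conj_croot w0) conjCK.
have E87 : h x8 x7 = w ^+ 2 by rewrite hC E78 (conj_croot w0).
have S4 k : k \in B -> h x4 k = w ^+ 2 * h x3 k.
  apply: (block_shift hadh h_o w0 B3 hpA hqA sumE w2_0 A3' A4 n34 E34).
  (* All three terms of the sum over [A] equal [w ^+ 2]. *)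
  by rewrite AE sum_set3 // !hd E34 E35 E54; ring.
have S5 k : k \in B -> h x5 k = w ^+ 2 * h x4 k.
  apply: (block_shift hadh h_o w0 B3 hpA hqA sumE w2_0 A4 A5 n45 E45).
  rewrite AE sum_set3 // !hd E45 E35 (hC x3 x4) E34 -(conj_croot w0) conjCK.
  by rewrite (conj_croot w0); ring.
have S7 k : k \in A -> h x7 k = w * h x6 k.
  apply: (block_shift hadh h_o w2_0 A3 hpB hqB' sumE' w0 B6 B7 n67 E67).
  by rewrite BE sum_set3 // !hd E67 E68 E87 -expr2 w2_w2; ring.
have S8 k : k \in A -> h x8 k = w * h x7 k.
  apply: (block_shift hadh h_o w2_0 A3 hpB hqB' sumE' w0 B7 B8 n78 E78).
  rewrite BE sum_set3 // !hd E78 E68 (hC x6 x7) E67 (conj_croot w0) -expr2 w2_w2; ring.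
have S7' k : k \in A -> h k x7 = h k x6 * w ^+ 2.
  by move=> kA; rewrite (hC x7) S7 // rmorphM /= (conj_croot w0) -hC mulrC.
have S8' k : k \in A -> h k x8 = h k x7 * w ^+ 2.
  by move=> kA; rewrite (hC x8) S8 // rmorphM /= (conj_croot w0) -hC mulrC.
set s := [:: o; p; q; x3; x4; x5; x6; x7; x8].
have s_all l : l \in s.
  (* Sum the indicator of [l]: an index missing from [s] would give [1 = 0]. *)
  have := sumE (fun k => (k == l)%:R).
  rewrite (bigD1 l) //= eqxx big1 ?addr0 => [|k /negPf -> //].
  rewrite AE BE !sum_set3 // => E; apply: contraT; move: E.
  rewrite !inE !(eq_sym l) !negb_or => /esym E.
  do 8![case/andP => /negPf El; rewrite {}El in E] => /negPf El; move: E; rewrite El.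
  by rewrite !addr0 => /esym/eqP; rewrite oner_eq0.
have s_uniq : uniq s.
  apply: (leq_size_uniq (enum_uniq 'I_9)) => [l _|]; first exact: s_all.
  by rewrite size_enum_ord.
have s_inj : injective (fun i : 'I_9 => nth o s i).
  by move=> i j /eqP; rewrite nth_uniq // => /eqP /val_inj.
exists (h x3 x6), (perm s_inj); split; first exact: h1.
move=> i j; rewrite !permE; apply: H9_entries => //; auto.
all: rewrite ?S7' // ?S8' // ?S7' // ?S5 // ?S4 //.
all: by ring: w3.
Qed.
End NormalForm.

(** This is conjugation by the diagonal matrix with entries [h o i], which turns row [o] into
    ones. *)
Lemma sa_hadamard9_normalize (C : numClosedFieldType) (h : 'I_9 -> 'I_9 -> C) o :
  sa_hadamard9 h -> sa_hadamard9 (phase h o).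
Proof.
move=> hadh; have [hC h1 hd h9] := hadh; split.
- by move=> i j; rewrite phase_rot phase_conj // -phase_rot.
- by move=> i j; exact: norm_phase.
- by move=> i; exact: phase_right.
- move=> i j; transitivity (h o i * h j o * \sum_k h i k * h k j).
    rewrite mulr_sumr; apply: eq_bigr => k _; rewrite /phase.
    by ring: (entry_mul_sym hadh o k).
  rewrite h9; case: eqP => [->|_]; last by rewrite !mulr0.
  by rewrite entry_mul_sym // mul1r.
Qed.

Local Open Scope complex_scope.
Local Open Scope sesquilinear_scope.
Unset Implicit Arguments.

Theorem theorem4p6 (R : realType) (H : 'M[R[i]]_9)
    (hadH : complex_hadamard H) (saH : H \is hermsymmx)
    (diagH : forall i : 'I_9, H i i = 1) :
  exists a : R[i], `|a| = 1 /\ hermitian_equiv H (H9 a).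
Proof.
have [H1 HH] := hadH.
have HC i j : H j i = Num.conj (H i j).
  by move/is_hermitianmxP : saH => /(congr1 (fun M : 'M_9 => M j i)); rewrite !mxE /= mul1r.
have hadh : sa_hadamard9 (fun i j => H i j).
  split=> // i j; have := congr1 (fun M : 'M_9 => M i j) HH; rewrite !mxE mulr_natr => <-.
  by apply: eq_bigr => k _; rewrite !mxE -HC.
have [o [p [q [op qo qp fe]]]] := exists_flat_phase (omega_root R) hadh.
have pE x : phase (fun i j => H i j) o o x = 1 by rewrite phase_rot phase_left.
rewrite eq_sym in qo; rewrite eq_sym in qp.
have [a [s [a1 sE]]] := exists_ordering (sa_hadamard9_normalize o hadh) pE op qo qp fe.
exists a; split=> //.
(* With this diagonal, [phase o i j] is the entry of the conjugated matrix, as [H j o] is the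
   conjugate of [H o j]. *)
pose d : 'rV[R[i]]_9 := \row_j H o j.
exists (perm_mx s), (diag_mx d); split.
- exact: perm_mx_is_perm.
- exact: diag_mx_is_diag.
- apply/unitarymxP/matrixP => i j; rewrite mul_diag_mx !mxE.
  rewrite [j == i]eq_sym; case: eqP => [->|_]; last by rewrite rmorph0 mulr0.
  by rewrite -normCK H1 expr1n.
- apply/matrixP => i j; rewrite sE tr_perm_mx -col_permE -!mulmxA -row_permE.
  by rewrite tr_diag_mx map_diag_mx mul_mx_diag mul_diag_mx !mxE /phase (HC o (s j)) mulrA.
Qed.
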